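(* Let $X\neq\{0\}$ be a real Banach space and let $T:X\rightrightarrows X^*$ be a maximal monotone operator whose domain $D(T)$ is not a singleton and such that ${}^{ic}D(T)\neq\emptyset$. Then the graph of $T$ is closed in $X\times X^*$ for the norm$\times$weak-star topology.
   Context: $X^*$ is the topological dual of $X$, $\langle x,x^*\rangle:=x^*(x)$. A multifunction $T:X\rightrightarrows X^*$ is identified with its graph $\{(x,x^* )\mid x^*\in T(x)\}$; $D(T)=\{x\mid T(x)\neq\emptyset\}$. $T$ is monotone if $\langle x_1-x_2,x_1^*-x_2^*\rangle\ge0$ for all $(x_1,x_1^* ),(x_2,x_2^* )\in T$; it is maximal monotone if it is monotone and its graph is not properly contained in the graph of another monotone operator $X\rightrightarrows X^*$. For $S\subset X$, the relative algebraic interior ${}^{i}S$ is the set of $s\in S$ such that for every $u\in\operatorname{aff}S$ (affine hull) there is $\rho>0$ with $(1-\lambda)s+\lambda u\in S$ for all $\lambda\in[0,\rho]$; ${}^{ic}S:={}^{i}S$ if $\operatorname{aff}S$ is norm closed, ${}^{ic}S:=\emptyset$ otherwise. *)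

(* Defs.v *)
From HB Require Import structures.
From mathcomp Require Import all_boot all_order all_algebra.
From mathcomp Require Import all_classical all_reals topology normedtype.
Set Implicit Arguments.
Unset Strict Implicit.
Unset Printing Implicit Defensive.
Import Order.TTheory GRing.Theory Num.Theory.
Import numFieldNormedType.Exports.
Local Open Scope classical_set_scope.
Local Open Scope ring_scope.

Record dual (R : realType) (X : normedModType R) := Dual {
  dual_linear :> {linear X -> R^o} ;
  dual_continuous : continuous dual_linear }.

HB.instance Definition _ (R : realType) (X : normedModType R) :=
  gen_eqMixin (dual X).
HB.instance Definition _ (R : realType) (X : normedModType R) :=
  gen_choiceMixin (dual X).

Definition dual_eval (R : realType) (X : normedModType R) (f : dual X) :
  {ptws X -> R^o} := fun x => f x.

(* The topology induced by pointwise convergence is the coarsest one that makes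
   every evaluation f |-> f x continuous. The alias keeps it off [dual X]. *)
Definition weak_star (R : realType) (X : normedModType R) : Type := dual X.

HB.instance Definition _ (R : realType) (X : normedModType R) :=
  Topological.copy (weak_star X) (initial_topology (@dual_eval R X)).

Definition pairing (R : realType) (X : normedModType R) (x : X) (f : X -> R) : R :=
  f x.

Section multifunction.
Variables (R : realType) (X : normedModType R).
Implicit Types T : X -> set (dual X).

Definition graph T : set (X * dual X) := [set p | T p.1 p.2].

Definition domain T : set X := [set x | T x !=set0].

Definition monotone T : Prop :=
  forall p q : X * dual X, graph T p -> graph T q ->
    0 <= pairing (p.1 - q.1) (p.2 \- q.2).

Definition maximal_monotone T : Prop :=
  monotone T /\
  forall T' : X -> set (dual X), monotone T' -> ~ (graph T `<` graph T').

End multifunction.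

Section algebraic_interior.
Variables (R : realType) (X : normedModType R).
Implicit Types S : set X.

Definition affine_set S : Prop :=
  forall (x y : X) (t : R), S x -> S y -> S ((1 - t) *: x + t *: y).

Definition aff S : set X := smallest affine_set S.

Definition relative_algebraic_interior S : set X :=
  [set s | S s /\ forall u, aff S u ->
    exists2 rho : R, 0 < rho &
      forall l : R, 0 <= l <= rho -> S ((1 - l) *: s + l *: u)].

Definition ic_interior S : set X :=
  if `[< closed (aff S) >] then relative_algebraic_interior S else set0.

End algebraic_interior.

(* Main.v *)
(** Fix [z] in the relative algebraic interior of [D(T)] with [(z, z')] in the
    graph, and let [Y] be the direction of the closed affine hull of [D(T)].
    For [u] in [Y] the point [z + rho u] lies in [D(T)] for a small [rho > 0],
    and monotonicity against it bounds [<u, y' - z'>] by a constant multiple of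
    [1 + <y - z, y' - z'>], uniformly over the [(y, y')] of the graph with
    [|y - z| <= r].  By the uniform boundedness principle on [Y],
    [|y' - z'|_Y <= M (1 + <y - z, y' - z'>)].  If [(a, a')] in the graph is
    norm x weak-star close to [(x, x')], then [a - x] lies in [Y] and
    [<a - z, a' - z'>] is [<a - x, a' - z'>] plus a bounded term, so this
    estimate absorbs its own right-hand side: [a'] stays bounded on [Y] although
    weak-star neighbourhoods are unbounded.  Hence [<a - x, a'>] tends to [0],
    and monotonicity passes to the limit. *)
Require Import Defs.
From mathcomp Require Import all_boot all_order all_algebra.
From mathcomp Require Import all_classical all_reals topology normedtype.
From mathcomp Require Import ring lra.
Import Order.TTheory GRing.Theory Num.Theory.
Import numFieldNormedType.Exports.
Local Open Scope classical_set_scope.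
Local Open Scope ring_scope.

(** * Uniform boundedness on a closed subspace *)

Lemma nested_closed_balls (R : realType) (X : completeNormedModType R)
    (x : nat -> X) (r : nat -> R) :
  (forall n, r n <= n.+1%:R^-1) ->
  (forall n m, (n <= m)%N -> `|x m - x n| <= r n) ->
  exists2 l : X, x n @[n --> \oo] --> l & forall n, `|l - x n| <= r n.
Proof.
move=> rn xr.
have cx : cvg (x n @[n --> \oo]).
  apply: cauchy_cvg; apply: cauchy_exP => e e0.
  exists (x (Num.truncn e^-1)), (Num.truncn e^-1) => // m /= nm.
  rewrite -ball_normE /= distrC (le_lt_trans (xr _ _ nm))// (le_lt_trans (rn _))//.
  by rewrite -[ltRHS]invrK ltf_pV2 ?posrE ?invr_gt0// truncnS_gt.
exists (lim (x n @[n --> \oo])) => // n.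
have : closed_ball_ Num.norm (x n) (r n) (lim (x n @[n --> \oo])).
  apply: (closed_cvg _ _ _ _ cx); first exact: closed_closed_ball_.
  by exists n => // m /= nm; rewrite /closed_ball_ /= distrC xr.
by rewrite /closed_ball_ /= distrC.
Qed.

(** Without a uniform bound, every ball centred in [Y] contains points of [Y] with arbitrarily large
    values. Nested balls, the [n]-th one carrying some [|f i| > n] throughout, then shrink to a
    point of [Y] that contradicts the pointwise bound. *)
Lemma uniform_bounded_subspace (R : realType) (X : completeNormedModType R)
    (Y : set X) (I : Type) (D : set I) (f : I -> {linear X -> R^o}) :
  closed Y -> Y 0 -> (forall a u v, Y u -> Y v -> Y (a *: u + v)) ->
  (forall i, D i -> continuous (f i)) ->
  (forall u, Y u -> exists M, forall i, D i -> `|f i u| <= M) ->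
  exists M, forall i u, D i -> Y u -> `|f i u| <= M * `|u|.
Proof.
move=> clY Y0 Ylin cf bf; apply: contrapT => unb.
have large (n : nat) x r : Y x -> 0 < r ->
    exists i y, [/\ D i, Y y, `|y - x| < r & n%:R < `|f i y|].
  move=> Yx r0; apply: contrapT => small; apply: unb.
  have smallP i y : D i -> Y y -> `|y - x| < r -> `|f i y| <= n%:R.
    by move=> Di Yy yx; rewrite leNgt; apply/negP => ny; apply: small; exists i, y.
  (* [c *: u] has norm [r / 2], so [f i (c *: u)] is a difference of two values bounded by [n];
     dividing by [c] gives this constant. *)
  exists (2 * n%:R / (r / 2)) => i u Di Yu.
  have [->|u0] := eqVneq u 0; first by rewrite linear0 !normr0 mulr0.
  have nu0 : 0 < `|u| by rewrite normr_gt0.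
  pose c := r / 2 / `|u|.
  have c0 : 0 < c by rewrite !divr_gt0.
  have : `|f i (c *: u)| <= 2 * n%:R.
    have -> : f i (c *: u) = f i (c *: u + x) - f i x by rewrite linearD addrK.
    have := ler_normB (f i (c *: u + x)) (f i x).
    have := smallP i (c *: u + x) Di (Ylin _ _ _ Yu Yx).
    rewrite addrK normrZ (gtr0_norm c0) /c divfK ?gt_eqF// => /(_ _).
    have := smallP i x Di Yx; rewrite subrr normr0 => /(_ r0) h1 h2.
    have /h2 : r / 2 < r by lra.
    lra.
  rewrite linearZ normrZ (gtr0_norm c0) -ler_pdivlMl// => /le_trans; apply.
  by rewrite /c invf_div mulrC mulrA mulrAC.
have step (n : nat) x r : Y x -> 0 < r -> exists p : X * R,
    [/\ Y p.1, 0 < p.2 <= n.+1%:R^-1, `|p.1 - x| + p.2 <= r &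
     exists2 i, D i & forall w, `|w - p.1| <= p.2 -> n%:R < `|f i w|].
  move=> Yx r0; have [i [y [Di Yy yx ny]]] := large n x r Yx r0.
  have /nbhs_normP[e /= e0 be] : \forall w \near y, n%:R < `|f i w|.
    have cn : {for y, continuous (fun w => `|f i w|)}.
      by apply: continuous_comp; [exact: cf|exact: norm_continuous].
    by apply: (cn [set t | n%:R < t]); apply: lt_nbhsr.
  (* The three bounds make the radii tend to 0, keep the closed ball where [|f i| > n], and nest it
     in the previous ball. *)
  pose d := Num.min n.+1%:R^-1 (Num.min (e / 2) (r - `|y - x|)).
  have d1 : d <= n.+1%:R^-1 by rewrite /d ge_min lexx.
  have d2 : d <= e / 2 by rewrite /d !ge_min lexx orbT.
  have d3 : d <= r - `|y - x| by rewrite /d !ge_min lexx !orbT.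
  have d0 : 0 < d by rewrite /d !lt_min invr_gt0 ltr0n divr_gt0//= subr_gt0.
  exists (y, d); split => //=; first by rewrite d0.
    by rewrite -lerBrDl.
  by exists i => // w wy; apply: be; rewrite /= distrC; lra.
(* The relation must be total, so the side conditions become premises and [(0, 0)] is a dummy value
   where they fail. *)
have /choice[g gP] (a : nat * (X * R)) : exists p : X * R,
    Y a.2.1 -> 0 < a.2.2 -> [/\ Y p.1, 0 < p.2 <= a.1.+1%:R^-1,
      `|p.1 - a.2.1| + p.2 <= a.2.2 &
     exists2 i, D i & forall w, `|w - p.1| <= p.2 -> a.1%:R < `|f i w|].
  have [[Ya a0]|na] := pselect (Y a.2.1 /\ 0 < a.2.2).
    by have [p pP] := step a.1 a.2.1 a.2.2 Ya a0; exists p.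
  by exists (0, 0) => Ya a0; case: na.
pose fix s n : X * R := if n is m.+1 then g (m.+1, s m) else g (0%N, (0, 1)).
have sP n : [/\ Y (s n).1, 0 < (s n).2 <= n.+1%:R^-1 &
     exists2 i, D i & forall w, `|w - (s n).1| <= (s n).2 -> n%:R < `|f i w|].
  elim: n => [|n [Yn /andP[rn _] _]] /=.
    by have [] := gP (0%N, (0, 1)) Y0 ltr01.
  by have [] := gP (n.+1, s n) Yn rn.
have sS n : `|(s n.+1).1 - (s n).1| + (s n.+1).2 <= (s n).2.
  by have [Yn /andP[rn _] _] := sP n; have [] := gP (n.+1, s n) Yn rn.
have sD n k : `|(s (k + n)%N).1 - (s n).1| + (s (k + n)%N).2 <= (s n).2.
  elim: k => [|k IH]; first by rewrite subrr normr0 add0r.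
  have := sS (k + n)%N; rewrite -addSn.
  have := ler_distD (s (k + n)%N).1 (s (k.+1 + n)%N).1 (s n).1.
  lra.
have [||l sl lP] := @nested_closed_balls R X (fun n => (s n).1) (fun n => (s n).2).
- by move=> n; have [_ /andP[]] := sP n.
- move=> n m nm; have := sD n (m - n)%N; rewrite subnK//.
  by have [_ /andP[r0 _] _] := sP m; lra.
have Yl : Y l by apply: (closed_cvg _ clY _ _ sl); apply: nearW => n; have [] := sP n.
have [M bM] := bf l Yl.
have [_ _ [i Di /(_ l (lP _))]] := sP (Num.truncn M).+1.
apply/negP; rewrite -leNgt (le_trans (bM i Di))//.
exact/ltW/truncnS_gt.
Qed.

(** * Dual norms, affine hulls and weak-star closure points *)

Lemma dual_bounded (R : realType) (X : normedModType R) (f : dual X) :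
  exists2 K, 0 <= K & forall x, `|f x| <= K * `|x|.
Proof.
have /linear_bounded_continuous/linear_boundedP fb := @dual_continuous _ _ f.
near (pinfty_nbhs R) => K; exists K => //.
by near: K.
Unshelve. all: by end_near. Qed.

Lemma aff_affine (R : realType) (X : normedModType R) (S : set X) :
  affine_set (aff S).
Proof.
move=> x y t Sx Sy A SA; have [affA _] := SA.
by apply: affA; [exact: Sx|exact: Sy].
Qed.

(** The target is the midpoint of [z + 2a u] and [z + 2v], each on a line through [z]. *)
Lemma affine_set_direction (R : realType) (X : normedModType R) (A : set X) z :
  affine_set A -> A z -> forall a u v,
  A (z + u) -> A (z + v) -> A (z + (a *: u + v)).
Proof.
move=> affA Az a u v Au Av.
have dil b w : A (z + w) -> A (z + b *: w).
  move=> Aw; have := affA _ _ b Az Aw.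
  by rewrite scalerDr addrA -scalerDl subrK scale1r.
have := affA _ _ 2^-1 (dil (2 * a) _ Au) (dil 2 _ Av).
rewrite !scalerDr !scalerA mulrA mulVf ?pnatr_eq0// scale1r addrACA -scalerDl.
by rewrite subrK scale1r (_ : (1 - 2^-1) * 2 = 1) ?mul1r//; lra.
Qed.

Lemma weak_star_eval_continuous (R : realType) (X : normedModType R) (w : X) :
  continuous (fun f : weak_star X => dual_eval f w).
Proof.
move=> f; apply: (@continuous_comp _ _ _ (@dual_eval R X : weak_star X -> _)
  (fun g : {ptws X -> R^o} => g w)); first exact: initial_continuous.
exact: proj_continuous.
Qed.

(** A single approximant replaces a net. Two test vectors suffice later: [x - z] for the a priori
    bound, [x - y] for the final inequality. *)
Lemma closure_norm_weak_star (R : realType) (X : normedModType R)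
    (G : set (X * dual X)) x (xs : dual X) w1 w2 e :
  closure (G : set (X * weak_star X)) (x, xs : weak_star X) -> 0 < e ->
  exists a (ys : dual X), [/\ G (a, ys), `|a - x| < e,
    `|ys w1 - xs w1| < e & `|ys w2 - xs w2| < e].
Proof.
move=> clG e0.
have near_eval w : \forall p \near ((x, xs) : X * weak_star X),
    `|(p.2 : dual X) w - xs w| < e.
  have /cvgrPdist_lt/(_ e e0) : dual_eval p.2 w @[p --> ((x, xs) : X * weak_star X)]
      --> (xs w : R^o).
    apply: (cvg_comp _ (fun f : weak_star X => dual_eval f w)); first exact: cvg_snd.
    exact: weak_star_eval_continuous.
  by apply: filterS => p; rewrite distrC.
have near_fst : \forall p \near ((x, xs) : X * weak_star X), `|p.1 - x| < e.
  have /cvgrPdist_lt/(_ e e0) : p.1 @[p --> ((x, xs) : X * weak_star X)] --> x.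
    exact: cvg_fst.
  by apply: filterS => p; rewrite distrC.
have [[a ys] [Gp [? [? ?]]]] :=
  clG _ (filterI near_fst (filterI (near_eval w1) (near_eval w2))).
by exists a, ys.
Qed.

(** * Monotone operators and the limit argument *)

(** Adjoining [(x, xs)] to the graph keeps it monotone, so maximality forces the pair to be there
    already. *)
Lemma maximal_monotone_related (R : realType) (X : normedModType R)
    (T : X -> set (dual X)) x (xs : dual X) :
  maximal_monotone T ->
  (forall y (ys : dual X), T y ys -> 0 <= xs (x - y) - ys (x - y)) -> T x xs.
Proof.
move=> [monT maxT] rel; apply: contrapT => nTx.
pose T' y : set (dual X) := [set ys | T y ys \/ (y = x /\ ys = xs)].
apply: (maxT T'); last first.
  split; first by move=> p; left.
  by move=> /(_ (x, xs)) sub; apply: nTx; apply: sub; right.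
move=> [y ys] [v vs]; rewrite /graph /pairing /= => -[Ty|[-> ->]] [Tv|[-> ->]].
- exact: (monT (y, ys) (v, vs)).
- have := rel y ys Ty.
  by rewrite -[x - y]opprB !linearN/= opprK addrC.
- exact: rel.
- by rewrite /GRing.sub_fun /= subrr.
Qed.

(** The last factor is at least 1 by monotonicity; dividing [ys - zs] by it yields a family that is
    bounded at each direction [u], so uniform boundedness applies. *)
Lemma monotone_bound (R : realType) (X : completeNormedModType R)
    (T : X -> set (dual X)) z (zs : dual X) r :
  monotone T -> closed (aff (domain T)) ->
  relative_algebraic_interior (domain T) z -> T z zs ->
  exists2 M, 0 < M & forall y (ys : dual X) u,
    T y ys -> `|y - z| <= r -> aff (domain T) (z + u) ->
    `|ys u - zs u| <= M * `|u| * (1 + (ys (y - z) - zs (y - z))).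
Proof.
move=> monT clA [Dz coreDz] Tz.
set A := aff (domain T) in clA *.
have Az : A z by move=> B [_]; apply.
pose gap (p : X * dual X) := 1 + (p.2 (p.1 - z) - zs (p.1 - z)).
have gap1 p : graph T p -> 1 <= gap p.
  by move=> Tp; rewrite lerDl; exact: (monT p (z, zs)).
pose D := [set p | graph T p /\ `|p.1 - z| <= r].
pose f p : {linear X -> R^o} := (gap p)^-1 \*: (p.2 \- zs).
have fE p u : f p u = (gap p)^-1 * (p.2 u - zs u) by [].
have [|||p _|u Au|M fM] :=
  @uniform_bounded_subspace R X [set u | A (z + u)] _ D f.
- apply: closed_comp clA => u _ /=.
  by apply: cvgD; [exact: cvg_cst|exact: cvg_id].
- by rewrite /= addr0.
- by move=> a u v; apply: affine_set_direction => //; exact: aff_affine.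
- move=> u; apply: cvgZr; apply: cvgB; exact: dual_continuous.
- have upper v : A (z + v) -> exists M, forall p, D p -> f p v <= M.
    move=> /coreDz[rho rho0 /(_ rho)].
    rewrite ltW// lexx => /(_ isT).
    rewrite scalerDr addrA -scalerDl subrK scale1r => -[vs Tvs].
    have [K K0 vsK] := dual_bounded _ _ vs.
    have [L L0 zsL] := dual_bounded _ _ zs.
    (* With [|w| <= rho |v| + r], [C] bounds [|vs w| + |zs w|] for the [w] below. Monotonicity gives
       [rho (p.2 v - zs v) <= gap p - 1 + C <= (1 + C) gap p], hence the witness. *)
    pose C := (K + L) * (rho * `|v| + r).
    exists ((1 + C) / rho) => p [Tp pr].
    have g1 := gap1 _ Tp.
    have := monT (_, vs) p Tvs Tp; rewrite /pairing /=.
    have -> : z + rho *: v - p.1 = rho *: v - (p.1 - z).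
      by rewrite opprB addrCA addrA.
    set w := rho *: v - (p.1 - z).
    have wC : `|vs w| + `|zs w| <= C.
      have wr : `|w| <= rho * `|v| + r.
        by rewrite (le_trans (ler_normB _ _))// normrZ gtr0_norm// lerD2l.
      have := vsK w; have := zsL w; rewrite /C mulrDl.
      have := ler_wpM2l K0 wr; have := ler_wpM2l L0 wr; lra.
    have C0 : 0 <= C by apply: le_trans wC; rewrite addr_ge0.
    have := ler_norm (vs w); have := ler_norm (- zs w); rewrite normrN.
    have pw : p.2 w - zs w = rho * (p.2 v - zs v) - (gap p - 1).
      by rewrite /w !linearB !linearZ /gap /= linearB /= /GRing.scale /=; ring.
    move=> h1 h2 h3.
    rewrite /GRing.scale /= mulrC ler_pdivrMr ?(lt_le_trans ltr01)//.
    rewrite mulrAC ler_pdivlMr// mulrC.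
    nra.
  (* The bound is one-sided; using it at both [u] and [- u] controls the absolute value. *)
  have [M1 fM1] := upper _ Au.
  have [|M2 fM2] := upper (- u).
    have := affine_set_direction _ _ _ _ (aff_affine _ _ _) Az (-1) u 0 Au.
    by rewrite !addr0 scaleN1r; apply.
  exists (Num.max M1 M2) => p Dp; rewrite ler_norml le_max fM1//= andbT.
  by have := fM2 p Dp; rewrite linearN => fM2p; rewrite lerNl le_max fM2p orbT.
- exists (`|M| + 1); first by rewrite ltr_wpDl.
  move=> y ys u Ty yr Au.
  have g1 := gap1 (y, ys) Ty.
  have g0 : 0 < gap (y, ys) by rewrite (lt_le_trans ltr01).
  have := fM (y, ys) u (conj Ty yr) Au.
  rewrite fE /= normrM normfV (gtr0_norm g0) mulrC ler_pdivrMr// => /le_trans; apply.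
  rewrite ler_pM2r// ler_wpM2r// (le_trans (ler_norm _))// lerDl//.
Qed.

Theorem theorem38 (R : realType) (X : completeNormedModType R)
  (T : X -> set (dual X)) :
  [set: X] <> [set 0] ->
  maximal_monotone T ->
  (forall x : X, domain T <> [set x]) ->
  ic_interior (domain T) !=set0 ->
  closed (graph T : set (X * weak_star X)).
Proof.
move=> _ maxT _ [z]; rewrite /ic_interior; case: ifPn => // /asboolP clA zint.
have [monT _] := maxT.
have [[zs Tz] _] := zint.
set A := aff (domain T) in clA.
have affA : affine_set A by exact: aff_affine.
have domA y (ys : dual X) : T y ys -> A y by move=> Ty B [_]; apply; exists ys.
move=> [x xs] clx; apply: maximal_monotone_related => //= y ys Ty.
have Ax : A x.
  apply: clA => B /nbhs_normP[e /= e0 eB].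
  have [a [as_ [Ta ax _ _]]] := closure_norm_weak_star _ _ _ _ _ 0 0 e clx e0.
  by exists a; split; [exact: domA Ta|apply: eB; rewrite /= distrC].
(* The radius leaves room for every [a] within distance 1 of [x]. *)
have [M M0 bM] := monotone_bound _ _ _ _ _ (`|x - z| + 1) monT clA zint Tz.
have [K K0 zsK] := dual_bounded _ _ zs.
have [L L0 ysL] := dual_bounded _ _ ys.
pose c := `|xs (x - z) - zs (x - z)|.
have c0 : 0 <= c := normr_ge0 _.
(* [B * d] is the total error: [as_ - zs] on [a - x], then [zs] and [ys] on [a - x], then the
   weak-star error on [x - y]. *)
pose B := M * (2 * (3 + c)) + (K + L) + 1.
have B0 : 0 < B by rewrite ltr_wpDl// addr_ge0 ?addr_ge0// mulr_ge0 ?ltW//; lra.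
rewrite -oppr_le0; apply/ler_addgt0Pl => e e0; rewrite addr0.
(* These bounds serve, in order, to keep [a] within the radius, to get [M * d <= 1/2] for the
   absorption, and to make the error at most [e]. *)
pose d := Num.min 1 (Num.min (2 * M)^-1 (e / B)).
have d1 : d <= 1 by rewrite /d ge_min lexx.
have d2 : d <= (2 * M)^-1 by rewrite /d !ge_min lexx orbT.
have d3 : d <= e / B by rewrite /d !ge_min lexx !orbT.
have d0 : 0 < d by rewrite /d !lt_min ltr01 invr_gt0 mulr_gt0//= divr_gt0.
have [a [as_ [Ta ax az ay]]] :=
  closure_norm_weak_star _ _ _ _ _ (x - z) (x - y) d clx d0.
have ar : `|a - z| <= `|x - z| + 1 by have := ler_distD x a z; lra.
have Aax : A (z + (a - x)).
  have := affine_set_direction _ _ _ _ affA (domA _ _ Tz) (-1) (x - z) (a - z).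
  have shift w : z + (w - z) = w by rewrite addrCA subrr addr0.
  rewrite !shift scaleN1r opprB [z - x + _]addrC [a - z + _]addrA subrK.
  by apply => //; exact: domA Ta.
have := bM a as_ (a - x) Ta ar Aax.
set s := 1 + _.
have sE : s = 1 + (as_ (a - x) - zs (a - x)) + (as_ (x - z) - zs (x - z)).
  have -> : a - x = (a - z) - (x - z) by rewrite opprB addrA subrK.
  by rewrite /s !linearB /=; ring.
have Md : M * d <= 2^-1.
  by rewrite -ler_pdivlMl// -invfM mulrC (le_trans d2)// lef_pV2.
have dB : B * d <= e by rewrite mulrC -ler_pdivlMr.
have s1 : 1 <= s by rewrite lerDl; exact: (monT (a, as_) (z, zs)).
have adx : M * `|a - x| * s <= M * d * s.
  by rewrite ler_pM2r ?(lt_le_trans ltr01)// ler_pM2l// ltW.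
move=> /le_trans/(_ adx) bs.
have bs_half : M * d * s <= 2^-1 * s.
  by rewrite ler_pM2r// (lt_le_trans ltr01).
have wE : as_ (x - z) - zs (x - z) =
    (as_ (x - z) - xs (x - z)) + (xs (x - z) - zs (x - z)) by rewrite addrA subrK.
have cE : xs (x - z) - zs (x - z) <= c by exact: ler_norm.
(* Absorption: [s <= 1 + s/2 + d + c] with [d <= 1]. *)
have sle : s <= 2 * (3 + c).
  have := ler_norm (as_ (a - x) - zs (a - x)).
  have := ler_norm (as_ (x - z) - xs (x - z)).
  lra.
have Pd : `|as_ (a - x) - zs (a - x)| <= M * (2 * (3 + c)) * d.
  by rewrite (le_trans bs)// mulrAC ler_pM2r// ler_pM2l.
have zsd : `|zs (a - x)| <= K * d.
  by rewrite (le_trans (zsK _))// ler_wpM2l// ltW.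
have ysd : `|ys (a - x)| <= L * d.
  by rewrite (le_trans (ysL _))// ler_wpM2l// ltW.
have mon : 0 <= as_ (a - y) - ys (a - y) := monT (a, as_) (y, ys) Ta Ty.
(* The first term is nonnegative by monotonicity; all the others are errors counted in [B * d]. *)
have yE : xs (x - y) - ys (x - y) = (as_ (a - y) - ys (a - y)) -
   (as_ (a - x) - zs (a - x)) - (zs (a - x) - ys (a - x)) -
   (as_ (x - y) - xs (x - y)).
  have -> : a - y = (a - x) + (x - y) by rewrite addrA subrK.
  by rewrite !linearD /=; ring.
have := ler_norm (as_ (a - x) - zs (a - x)).
have := ler_norm (as_ (x - y) - xs (x - y)).
have := ler_norm (zs (a - x)).
have := ler_norm (- ys (a - x)); rewrite normrN.
have BE : B * d = M * (2 * (3 + c)) * d + (K * d + L * d) + d.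
  by rewrite /B; ring.
lra.
Qed.
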